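(* Let $\mathcal M$ be a type ${\rm II}_1$ factor with trace $\tau$ and let $x_1$ and $x_2$ be self-adjoint elements in $\mathcal M$. If there exist a positive number $\alpha>0$ and a projection $p\in\mathcal M$ with $\tau(p)>0$ satisfying $$\|[x_1,p]\|_2+\|[x_2,p]\|_2\ge\alpha\|p\|_2,$$ then $$\|[x_1,p]\|+\|[x_2,p]\|\ge\frac{\alpha}{\sqrt2}.$$
   Context: The trace $\tau$ is the unique faithful normal tracial state on $\mathcal M$; $\|\cdot\|$ is the operator norm, $\|x\|_2=\sqrt{\tau(x^*x)}$, and $[x,y]=xy-yx$. *)

(* Defs.v *)
From HB Require Import structures.
From mathcomp Require Import all_boot all_order all_algebra.
From mathcomp Require Import complex.
From mathcomp Require Import boolp classical_sets functions reals topology normedtype.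

Set Implicit Arguments.
Unset Strict Implicit.
Unset Printing Implicit Defensive.

Import Order.TTheory GRing.Theory Num.Theory.
Local Open Scope classical_set_scope.
Local Open Scope ring_scope.
Local Open Scope complex_scope.

(* A complex Hilbert space is a complete normed R[i]-module H together with an
   inner product dot (linear in its first argument) inducing its norm.
   Operators are plain functions H -> H, with the pointwise vector space
   structure, composition as product and idfun as unit. The norm of a vector is
   an element of R[i] (a nonnegative real), and z <= w in R[i] means that w - z
   is real and nonnegative. *)
Definition hilbert_dot (R : realType) (H : completeNormedModType R[i])
    (dot : {dot H for Num.conj}) : Prop :=
  forall u : H, dot u u = `|u| ^+ 2.

Definition bounded_op (R : realType) (H : completeNormedModType R[i])
    (x : H -> H) : Prop :=
  linear x /\ exists k : R, forall v, `|x v| <= k%:C * `|v|.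

Definition opnorm (R : realType) (H : completeNormedModType R[i])
    (x : H -> H) : R :=
  sup [set complex.Re `|x v| | v in [set v : H | `|v| <= 1]].

Definition is_adjoint (R : realType) (H : completeNormedModType R[i])
    (dot : {dot H for Num.conj}) (x y : H -> H) : Prop :=
  forall u v, dot (x u) v = dot u (y v).

(* The adjoint; it is unique when it exists, and exists for bounded x. *)
Definition adj (R : realType) (H : completeNormedModType R[i])
    (dot : {dot H for Num.conj}) (x : H -> H) : H -> H :=
  xget 0 [set y | is_adjoint dot x y].

Definition selfadjoint (R : realType) (H : completeNormedModType R[i])
    (dot : {dot H for Num.conj}) (x : H -> H) : Prop :=
  is_adjoint dot x x.

Definition positive_op (R : realType) (H : completeNormedModType R[i])
    (dot : {dot H for Num.conj}) (x : H -> H) : Prop :=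
  forall v, 0 <= dot (x v) v.

Definition le_op (R : realType) (H : completeNormedModType R[i])
    (dot : {dot H for Num.conj}) (x y : H -> H) : Prop :=
  positive_op dot (y - x).

Definition commutant (R : realType) (H : completeNormedModType R[i])
    (S : set (H -> H)) : set (H -> H) :=
  [set x | bounded_op x /\ forall y, S y -> x \o y = y \o x].

Definition von_neumann_algebra (R : realType) (H : completeNormedModType R[i])
    (dot : {dot H for Num.conj}) (M : set (H -> H)) : Prop :=
  [/\ M `<=` [set x | bounded_op x],
      forall x, M x -> exists2 y, M y & is_adjoint dot x y
    & commutant (commutant M) = M].

Definition vn_factor (R : realType) (H : completeNormedModType R[i])
    (dot : {dot H for Num.conj}) (M : set (H -> H)) : Prop :=
  [/\ von_neumann_algebra dot M,
      exists v : H, v != 0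
    & M `&` commutant M = [set c *: (idfun : H -> H) | c in [set: R[i]]]].

Definition projection (R : realType) (H : completeNormedModType R[i])
    (dot : {dot H for Num.conj}) (M : set (H -> H)) (p : H -> H) : Prop :=
  [/\ M p, p \o p = p & selfadjoint dot p].

(* Murray-von Neumann equivalence in M *)
Definition mvn_equiv (R : realType) (H : completeNormedModType R[i])
    (dot : {dot H for Num.conj}) (M : set (H -> H)) (p q : H -> H) : Prop :=
  exists v, [/\ M v, adj dot v \o v = p & v \o adj dot v = q].

Definition finite_projection (R : realType) (H : completeNormedModType R[i])
    (dot : {dot H for Num.conj}) (M : set (H -> H)) (p : H -> H) : Prop :=
  projection dot M p /\
  forall q, projection dot M q -> le_op dot q p -> mvn_equiv dot M p q -> q = p.

Definition abelian_projection (R : realType) (H : completeNormedModType R[i])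
    (dot : {dot H for Num.conj}) (M : set (H -> H)) (p : H -> H) : Prop :=
  projection dot M p /\
  forall x y, M x -> M y ->
    (p \o x \o p) \o (p \o y \o p) = (p \o y \o p) \o (p \o x \o p).

Definition type_II1_factor (R : realType) (H : completeNormedModType R[i])
    (dot : {dot H for Num.conj}) (M : set (H -> H)) : Prop :=
  [/\ vn_factor dot M,
      finite_projection dot M idfun
    & forall p, abelian_projection dot M p -> p = 0].

(* Normality: tau preserves suprema of bounded increasing nets of positive
   elements; such a net is given by the upward directed set D of its terms, and
   x is the supremum of D in M. *)
Definition normal_functional (R : realType) (H : completeNormedModType R[i])
    (dot : {dot H for Num.conj}) (M : set (H -> H))
    (tau : (H -> H) -> R[i]) : Prop :=
  forall (D : set (H -> H)) (x : H -> H),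
    D !=set0 ->
    D `<=` [set y | M y /\ positive_op dot y] ->
    (forall y z, D y -> D z ->
       exists w, [/\ D w, le_op dot y w & le_op dot z w]) ->
    M x ->
    (forall y, D y -> le_op dot y x) ->
    (forall z, M z -> (forall y, D y -> le_op dot y z) -> le_op dot x z) ->
    supremums (tau @` D) (tau x).

(* Only the values of tau on M are relevant. *)
Definition faithful_normal_tracial_state (R : realType)
    (H : completeNormedModType R[i]) (dot : {dot H for Num.conj})
    (M : set (H -> H)) (tau : (H -> H) -> R[i]) : Prop :=
  [/\ forall (a : R[i]) x y, M x -> M y ->
        tau (a *: x + y) = a * tau x + tau y,
      (forall x, M x -> positive_op dot x -> 0 <= tau x) /\ tau idfun = 1,
      forall x, M x -> positive_op dot x -> tau x = 0 -> x = 0,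
      forall x y, M x -> M y -> tau (x \o y) = tau (y \o x)
    & normal_functional dot M tau].

Definition norm2 (R : realType) (H : completeNormedModType R[i])
    (dot : {dot H for Num.conj}) (tau : (H -> H) -> R[i]) (x : H -> H) : R :=
  Num.sqrt (complex.Re (tau (adj dot x \o x))).

Definition commutator (R : realType) (H : completeNormedModType R[i])
    (x y : H -> H) : H -> H :=
  (x \o y) - (y \o x).

(* Main.v *)
Require Import Defs.
From HB Require Import structures.
From mathcomp Require Import all_boot all_order all_algebra.
From mathcomp Require Import complex.
From mathcomp Require Import boolp classical_sets functions reals topology normedtype.

Set Implicit Arguments.
Unset Strict Implicit.
Unset Printing Implicit Defensive.

Import Order.TTheory GRing.Theory Num.Theory.
Local Open Scope classical_set_scope.
Local Open Scope ring_scope.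
Local Open Scope complex_scope.

(** The norms of each commutator can be compared separately: if [c = [x, p]] with
    [x] self-adjoint and [p] a projection, then
      [||c||_2 <= sqrt 2 * ||c|| * ||p||_2]
    (lemma [norm2_off_diagonal_le]). Adding the two instances and dividing by
    [||p||_2], which is positive because [tau p] is, gives the theorem.

    Being a derivation applied to an idempotent, [c] satisfies [p c + c p = c],
    that is, it maps the ranges of [p] and of [1 - p] into each other
    ([commutator_off_diagonal]). Therefore [c^* c] is block diagonal with respect
    to [p] and, as [c^* = - c], the trace property makes its two blocks have
    equal trace ([trace_off_diagonal_sqr]):
      [||c||_2^2 = tau (c^* c) = 2 tau (p c^* c p)].
    The surviving block is supported under [p], even if [1 - p] is much larger,
    and [p c^* c p <= ||c||^2 p] ([compression_le]), so positivity of the trace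
    bounds the right-hand side by [2 ||c||^2 tau p = 2 ||c||^2 ||p||_2^2]. The
    factor [sqrt 2] thus accounts for the two off-diagonal corners of [c]. *)

(** * Inner products and adjoints *)

(** Operators are bare functions here; this gives access to the theory of
    bundled linear maps. *)
Lemma linear_bundle (R : nzRingType) (U V : lmodType R) (f : U -> V) :
  linear f -> exists F : {linear U -> V}, f = F.
Proof.
move=> lf.
by exists (HB.pack_for {linear U -> V} f (GRing.isLinear.Build _ _ _ _ f lf)).
Qed.

(* The general lemmas on forms see [dot] through the coercions to bilinear and
   hermitian forms, where rewriting with hypotheses on [dot] finds no match;
   hence these restatements. *)
Lemma dotC (R : realType) (H : completeNormedModType R[i])
    (dot : {dot H for Num.conj}) (u v : H) : dot u v = Num.conj (dot v u).
Proof. by have := hermC dot u v; rewrite expr0 mul1r. Qed.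

Lemma dotBr (R : realType) (H : completeNormedModType R[i])
    (dot : {dot H for Num.conj}) (u v w : H) :
  dot u (v - w) = dot u v - dot u w.
Proof. exact: linearBr. Qed.

Lemma dotBl (R : realType) (H : completeNormedModType R[i])
    (dot : {dot H for Num.conj}) (u v w : H) :
  dot (u - v) w = dot u w - dot v w.
Proof. exact: linearBl. Qed.

Lemma dotZl (R : realType) (H : completeNormedModType R[i])
    (dot : {dot H for Num.conj}) (a : R[i]) (u v : H) :
  dot (a *: u) v = a * dot u v.
Proof. exact: linearZl_LR. Qed.

Lemma is_adjoint_sym (R : realType) (H : completeNormedModType R[i])
    (dot : {dot H for Num.conj}) (x y : H -> H) :
  is_adjoint dot x y -> is_adjoint dot y x.
Proof. by move=> xy u v; rewrite dotC -xy -dotC. Qed.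

(** [adj] is a choice among all adjoints, and definiteness of the inner product
    leaves only one candidate. *)
Lemma adjE (R : realType) (H : completeNormedModType R[i])
    (dot : {dot H for Num.conj}) (Hdot : hilbert_dot dot) (x y : H -> H) :
  is_adjoint dot x y -> adj dot x = y.
Proof.
move=> xy; rewrite /adj; case: xgetP => [z _ xz|/(_ y)//].
apply/funext => v; apply/eqP; rewrite -subr_eq0 -normr_eq0 -sqrf_eq0 -Hdot.
by rewrite dotBr -xz -xy subrr.
Qed.

(** * The operator norm *)

Lemma ge0_RRe (R : rcfType) (z : R[i]) : 0 <= z -> (complex.Re z)%:C = z.
Proof. by move=> z0; rewrite RRe_real// ger0_real. Qed.

(** Without this bound, the supremum in [opnorm] would be a junk value. *)
Lemma opnorm_has_ubound (R : realType) (H : completeNormedModType R[i])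
    (x : H -> H) : bounded_op x ->
  has_ubound [set complex.Re `|x v| | v in [set v : H | `|v| <= 1]].
Proof.
case=> _ [k xk]; exists `|k| => _ [v /= v1 <-].
rewrite -lecR ge0_RRe//; apply: (le_trans (xk v)).
apply: (@le_trans _ _ (`|k|%:C * `|v|)).
  by apply: ler_wpM2r => //; rewrite lecR ler_norm.
by apply: ler_piMr => //; rewrite ler0c.
Qed.

Lemma opnorm_ge0 (R : realType) (H : completeNormedModType R[i])
    (x : H -> H) : bounded_op x -> 0 <= opnorm x.
Proof.
move=> bx; apply: (@le_trans _ _ (complex.Re `|x 0|)).
  by rewrite -ler0c ge0_RRe.
by apply: ub_le_sup; [exact: opnorm_has_ubound | exists 0; rewrite //= normr0].
Qed.

(** Homogeneity extends the bound from the unit ball to the whole space. *)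
Lemma le_opnorm (R : realType) (H : completeNormedModType R[i])
    (x : H -> H) (v : H) : bounded_op x -> `|x v| <= (opnorm x)%:C * `|v|.
Proof.
move=> bx; have [lx _] := bx.
have [X xX] := linear_bundle lx; rewrite {}xX in bx *.
have [->|v0] := eqVneq v 0; first by rewrite linear0 !normr0 mulr0.
have nv : 0 < `|v| by rewrite normr_gt0.
rewrite -ler_pdivrMr// mulrC.
have -> : `|v|^-1 * `|X v| = `|X (`|v|^-1 *: v)|.
  by rewrite linearZ normrZ ger0_norm// invr_ge0.
rewrite -[leLHS]ge0_RRe// lecR.
apply: ub_le_sup; first exact: opnorm_has_ubound.
exists (`|v|^-1 *: v) => //=.
by rewrite normrZ ger0_norm ?invr_ge0// mulVf// gt_eqF.
Qed.

(** * Von Neumann algebras and traces *)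

(** A von Neumann algebra is a commutant, namely that of its own commutant, and
    what commutes with a set of linear maps is stable under the algebra
    operations. *)
Lemma vna_lin (R : realType) (H : completeNormedModType R[i])
    (dot : {dot H for Num.conj}) (M : set (H -> H)) (a : R[i]) (x y : H -> H) :
  von_neumann_algebra dot M -> M x -> M y -> M (a *: x + y).
Proof.
move=> [Mb _ MM] Mx My; have [[lx [k xk]] [ly [l yl]]] := (Mb _ Mx, Mb _ My).
rewrite -MM; split.
  split=> [b u v|].
    by rewrite !fctE lx ly !scalerDr !scalerA mulrC addrACA.
  exists (complex.Re `|a| * k + l) => v; rewrite !fctE.
  apply: (le_trans (ler_normD _ _)).
  have -> : (complex.Re `|a| * k + l)%:C = `|a| * k%:C + l%:C.
    by rewrite -[in RHS](ge0_RRe (normr_ge0 a)) -rmorphM -rmorphD.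
  rewrite normrZ mulrDl -mulrA.
  by apply: lerD => //; apply: ler_wpM2l.
move=> y' My'; have [[l' _] y'M] := My'; apply/funext => v.
have /(congr1 (@^~ v)) /= Ex := y'M _ Mx.
have /(congr1 (@^~ v)) /= Ey := y'M _ My.
by rewrite !fctE l' Ex Ey.
Qed.

Lemma vna_comp (R : realType) (H : completeNormedModType R[i])
    (dot : {dot H for Num.conj}) (M : set (H -> H)) (x y : H -> H) :
  von_neumann_algebra dot M -> M x -> M y -> M (x \o y).
Proof.
move=> [Mb _ MM] Mx My; have [[lx [k xk]] [ly [l yl]]] := (Mb _ Mx, Mb _ My).
rewrite -MM; split.
  split=> [b u v|] /=; first by rewrite ly lx.
  exists (`|k| * l) => v /=; apply: (le_trans (xk _)).
  apply: (@le_trans _ _ (`|k|%:C * `|y v|)).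
    by apply: ler_wpM2r => //; rewrite lecR ler_norm.
  by rewrite rmorphM -mulrA; apply: ler_wpM2l => //; rewrite ler0c.
move=> z [_ zM]; apply/funext => v.
have /(congr1 (@^~ (y v))) /= := zM _ Mx.
have /(congr1 (@^~ v)) /= := zM _ My.
by move=> -> ->.
Qed.

Lemma vna_sub (R : realType) (H : completeNormedModType R[i])
    (dot : {dot H for Num.conj}) (M : set (H -> H)) (x y : H -> H) :
  von_neumann_algebra dot M -> M x -> M y -> M (x - y).
Proof.
by move=> vM Mx My; rewrite addrC -scaleN1r; exact: (vna_lin _ vM).
Qed.

Lemma vna0 (R : realType) (H : completeNormedModType R[i])
    (dot : {dot H for Num.conj}) (M : set (H -> H)) (x : H -> H) :
  von_neumann_algebra dot M -> M x -> M 0.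
Proof. by move=> vM Mx; rewrite -(subrr x); exact: (vna_sub vM). Qed.

Lemma trace_mono (R : realType) (H : completeNormedModType R[i])
    (dot : {dot H for Num.conj}) (M : set (H -> H)) (tau : (H -> H) -> R[i])
    (x y : H -> H) :
  von_neumann_algebra dot M -> faithful_normal_tracial_state dot M tau ->
  M x -> M y -> le_op dot x y -> tau x <= tau y.
Proof.
move=> vM [taul [tau0 _] _ _ _] Mx My xy.
have := tau0 _ (vna_sub vM My Mx) xy.
by rewrite addrC -scaleN1r taul// mulN1r addrC subr_ge0.
Qed.

(** The hypothesis on [c] says that its matrix with respect to [p] and [1 - p]
    is off-diagonal, so that [c^2] is block diagonal. Its two blocks are products
    of the same corners of [c] in opposite orders, and the trace does not
    distinguish them; hence the factor 2. Formally
    [c^2 = p c^2 + c (p c)], whose two terms have the same trace. *)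
Lemma trace_off_diagonal_sqr (R : realType) (H : completeNormedModType R[i])
    (dot : {dot H for Num.conj}) (M : set (H -> H)) (tau : (H -> H) -> R[i])
    (p c : H -> H) :
  von_neumann_algebra dot M -> faithful_normal_tracial_state dot M tau ->
  M p -> p \o p = p -> M c -> (p \o c) + (c \o p) = c ->
  tau (c \o c) = tau (p \o (c \o c) \o p) *+ 2.
Proof.
move=> vM [taul _ _ tautr _] Mp pp Mc pcp.
have Mcc := vna_comp vM Mc Mc; have Mpc := vna_comp vM Mp Mc.
have Mpcc := vna_comp vM Mp Mcc.
have ppcc : tau (p \o (c \o c) \o p) = tau (p \o (c \o c)).
  by rewrite tautr// -[p \o (p \o _)]/((p \o p) \o (c \o c)) pp.
have cc : c \o c = 1 *: (p \o (c \o c)) + (c \o (p \o c)).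
  by rewrite scale1r; apply/funext => v; have /(congr1 (@^~ (c v)))/esym := pcp.
rewrite [in LHS]cc taul//; last exact: vna_comp vM Mc Mpc.
by rewrite mul1r ppcc (tautr c)// mulr2n.
Qed.

(** * Off-diagonal elements and commutators *)

Lemma dot_projection (R : realType) (H : completeNormedModType R[i])
    (dot : {dot H for Num.conj}) (Hdot : hilbert_dot dot) (p : H -> H) (v : H) :
  p \o p = p -> selfadjoint dot p -> dot (p v) v = `|p v| ^+ 2.
Proof. by move=> pp sp; rewrite -Hdot [RHS]sp -[p (p v)]/((p \o p) v) pp sp. Qed.

(** [<p d c p v, v> = |c p v|^2] when [d] is the adjoint of [c], and
    [<p v, v> = |p v|^2], so this is the operator norm bound at [p v]. *)
Lemma compression_le (R : realType) (H : completeNormedModType R[i])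
    (dot : {dot H for Num.conj}) (Hdot : hilbert_dot dot) (p c d : H -> H) :
  p \o p = p -> selfadjoint dot p -> bounded_op c -> is_adjoint dot c d ->
  le_op dot (p \o (d \o c) \o p) ((opnorm c ^+ 2)%:C *: p).
Proof.
move=> pp sp bc cd v; rewrite !fctE dotBl dotZl subr_ge0.
rewrite sp (is_adjoint_sym cd) Hdot.
rewrite (dot_projection Hdot _ pp sp) rmorphXn /= -exprMn.
rewrite ler_pXn2r// ?nnegrE ?mulr_ge0 ?ler0c ?opnorm_ge0//.
exact: le_opnorm.
Qed.

(** The core estimate: [||c||_2^2 = - tau (c^2) = 2 tau (p c^* c p)], and
    [p c^* c p <= ||c||^2 p]. *)
Lemma norm2_off_diagonal_le (R : realType) (H : completeNormedModType R[i])
    (dot : {dot H for Num.conj}) (Hdot : hilbert_dot dot) (M : set (H -> H))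
    (tau : (H -> H) -> R[i]) (p c : H -> H) :
  von_neumann_algebra dot M -> faithful_normal_tracial_state dot M tau ->
  projection dot M p -> M c -> is_adjoint dot c (- c) ->
  (p \o c) + (c \o p) = c ->
  norm2 dot tau c <= Num.sqrt 2 * opnorm c * norm2 dot tau p.
Proof.
move=> vM Htau [Mp pp sp] Mc cN pcp.
have bc : bounded_op c by case: vM => Mb _ _; exact: Mb.
have Mcc := vna_comp vM Mc Mc.
have Mpccp := vna_comp vM (vna_comp vM Mp Mcc) Mp.
have [taul [tau0 _] _ _ _] := Htau.
have M0 := vna0 vM Mc.
have tauZ a x : M x -> tau (a *: x) = a * tau x.
  move=> Mx.
  (* Linearity on M is stated for a *: x + y only, so tau 0 = 0 comes first. *)
  have t0 : tau 0 = 0.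
    have /eqP := taul 1 0 0 M0 M0.
    by rewrite scaler0 addr0 mul1r addrC -subr_eq subrr eq_sym => /eqP.
  by rewrite -[a *: x]addr0 taul// t0 addr0.
have [lp _] : bounded_op p by case: vM => Mb _ _; exact: Mb.
have [P pP] := linear_bundle lp.
rewrite /norm2 (adjE Hdot sp) (adjE Hdot cN) pp.
have -> : - c \o c = -1 *: (c \o c) by rewrite scaleN1r.
rewrite tauZ// (trace_off_diagonal_sqr vM Htau Mp pp Mc pcp) mulrnAr.
have le1 : -1 * tau (p \o (c \o c) \o p) <= (opnorm c ^+ 2)%:C * tau p.
  rewrite -!tauZ//.
  have Mk := vna_lin ((opnorm c ^+ 2)%:C) vM Mp M0; rewrite addr0 in Mk.
  have Mn := vna_lin (-1) vM Mpccp M0; rewrite addr0 in Mn.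
  apply: (trace_mono vM Htau Mn Mk).
  have -> : -1 *: (p \o (c \o c) \o p) = p \o ((- c) \o c) \o p.
    by apply/funext => v; rewrite scaleN1r !fctE pP linearN.
  exact: compression_le.
have Rle (z w : R[i]) : z <= w -> complex.Re z <= complex.Re w.
  by rewrite lecE => /andP[].
have taup0 : 0 <= tau p.
  by apply: tau0 => // v; rewrite (dot_projection Hdot _ pp sp) exprn_ge0.
have k0 := opnorm_ge0 bc.
apply: (@le_trans _ _ (Num.sqrt (2 * opnorm c ^+ 2 * complex.Re (tau p)))).
  apply: ler_wsqrtr; rewrite -mulrA.
  have := Rle _ _ (lerD le1 le1).
  rewrite -!mulr2n -[in X in _ <= X -> _](ge0_RRe taup0) -rmorphM.
  by rewrite [in X in _ <= X -> _]raddfMn mulr_natl.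
rewrite sqrtrM ?mulr_ge0 ?sqr_ge0// sqrtrM// sqrtr_sqr.
by rewrite ger0_norm.
Qed.

(** This is Leibniz's rule for the derivation [[x, _]] applied to [p = p^2]. *)
Lemma commutator_off_diagonal (R : realType) (H : completeNormedModType R[i])
    (x p : H -> H) : linear p -> p \o p = p ->
  (p \o commutator x p) + (commutator x p \o p) = commutator x p.
Proof.
move=> lp pp.
have [P pP] := linear_bundle lp.
have ppE v : p (p v) = p v by have /(congr1 (@^~ v)) := pp.
apply/funext => v; rewrite /commutator !fctE /=.
have -> : p (x (p v) - p (x v)) = p (x (p v)) - p (x v).
  by rewrite pP linearB -pP ppE.
by rewrite !ppE addrC addrA addrNK.
Qed.

Lemma commutator_skew_adjoint (R : realType) (H : completeNormedModType R[i])
    (dot : {dot H for Num.conj}) (x y : H -> H) :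
  selfadjoint dot x -> selfadjoint dot y ->
  is_adjoint dot (commutator x y) (- commutator x y).
Proof.
move=> sx sy u v; rewrite /commutator !fctE opprB dotBl dotBr.
by rewrite !sx !sy sx.
Qed.

Theorem lemma5p7 (R : realType) (H : completeNormedModType R[i])
    (dot : {dot H for Num.conj}) (Hdot : hilbert_dot dot)
    (M : set (H -> H)) (HM : type_II1_factor dot M)
    (tau : (H -> H) -> R[i])
    (Htau : faithful_normal_tracial_state dot M tau)
    (x1 x2 : H -> H) (Mx1 : M x1) (Mx2 : M x2)
    (sax1 : selfadjoint dot x1) (sax2 : selfadjoint dot x2)
    (alpha : R) (alpha_gt0 : 0 < alpha)
    (p : H -> H) (Hp : projection dot M p) (tau_p_gt0 : 0 < tau p)
    (Hcomm : norm2 dot tau (commutator x1 p) + norm2 dot tau (commutator x2 p)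
             >= alpha * norm2 dot tau p) :
  opnorm (commutator x1 p) + opnorm (commutator x2 p) >= alpha / Num.sqrt 2.
Proof.
have [[vM _ _] _ _] := HM; have [Mp pp sp] := Hp.
have [lp _] : bounded_op p by case: vM => Mb _ _; exact: Mb.
have norm2_le x : M x -> selfadjoint dot x ->
    norm2 dot tau (commutator x p)
      <= Num.sqrt 2 * opnorm (commutator x p) * norm2 dot tau p.
  move=> Mx sx; apply: (norm2_off_diagonal_le Hdot vM Htau Hp).
  - by apply: (vna_sub vM); exact: vna_comp vM _ _.
  - exact: commutator_skew_adjoint.
  - exact: commutator_off_diagonal.
have p2_gt0 : 0 < norm2 dot tau p.
  rewrite /norm2 (adjE Hdot sp) pp sqrtr_gt0.
  by move: tau_p_gt0; rewrite ltcE => /andP[].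
rewrite ler_pdivrMr ?sqrtr_gt0//.
rewrite -(ler_pM2r p2_gt0); apply: (le_trans Hcomm).
by rewrite mulrDl mulrDl ![_ * Num.sqrt 2]mulrC lerD ?norm2_le.
Qed.
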